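(* Let $\diamond$ be one of the unary operations minimal hitting set ($\mathcal{F}\mapsto\mathcal{F}^\sharp$) or closure ($\mathcal{F}\mapsto\mathcal{F}^\cap$). Then there exist, for each positive integer $m$, a finite ground set $U_m$ with $|U_m|=O(m^2)$, a total order $<_m$ on $U_m$, and a family $\mathcal{F}_m$ of subsets of $U_m$ such that $Z_{<_m}(\mathcal{F}_m)=O(m^4)$ and $Z_{<_m}(\mathcal{F}_m^\diamond)=\Omega(2^{m}/\mathrm{poly}(m))$, i.e. $Z_{<_m}(\mathcal{F}_m^\diamond)\ge 2^m/p(m)$ for some polynomial $p$ and all sufficiently large $m$.
   Context: A family of sets is a set of subsets of a finite ground set $U$. For a family $\mathcal{A}$, $\mathcal{A}^\downarrow=\{A\in\mathcal{A}\mid\forall A'\in\mathcal{A}: A'\subseteq A\Rightarrow A=A'\}$. Minimal hitting set: $\mathcal{F}^\sharp=\{S\subseteq U\mid \forall F\in\mathcal{F}: S\cap F\neq\emptyset\}^\downarrow$. Closure: $\mathcal{F}^\cap=\{\bigcap_{S\in\mathcal{F}'}S\mid \mathcal{F}'\subseteq\mathcal{F}\}$. A zero-suppressed binary decision diagram (ZDD) with respect to a total order $<$ on $U$ is a rooted DAG with two terminal nodes $\top,\bot$ and internal nodes $\mathtt{n}$, each with a label $\mathsf{lb}(\mathtt{n})\in U$ and children $\mathsf{lo}(\mathtt{n}),\mathsf{hi}(\mathtt{n})$, labels strictly increasing along arcs. A node represents: $\{\emptyset\}$ if $\top$, $\emptyset$ if $\bot$, and $\mathcal{F}_{\mathsf{lo}(\mathtt{n})}\cup\{\{\mathsf{lb}(\mathtt{n})\}\cup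 S\mid S\in\mathcal{F}_{\mathsf{hi}(\mathtt{n})}\}$ otherwise; the ZDD represents the family of its root. The reduced ZDD (obtained by merging nodes with identical label and children and deleting nodes whose hi-child is $\bot$) is the unique smallest ZDD for the family and order; $Z_<(\mathcal{F})$ is its number of nodes. Asymptotics are as $m\to\infty$. *)

(* Defs.v *)
From HB Require Import structures.
From mathcomp Require Import all_boot all_order all_algebra.

Set Implicit Arguments.
Unset Strict Implicit.
Unset Printing Implicit Defensive.

Section Families.
Variable U : finType.
Implicit Types A F : {set {set U}}.

Definition minimal_sets A : {set {set U}} :=
  [set S in A | [forall T in A, (T \subset S) ==> (S == T)]].

Definition hitting_sets F : {set {set U}} :=
  [set S | [forall T in F, S :&: T != set0]].

Definition minimal_hitting_sets F := minimal_sets (hitting_sets F).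

(* The empty subfamily is allowed; its intersection is the ground set. *)
Definition intersection_closure F : {set {set U}} :=
  [set \bigcap_(S in F') S | F' : {set {set U}} in powerset F].

End Families.

Inductive unary_op := MinimalHittingSet | Closure.

Definition apply_op (o : unary_op) (U : finType) (F : {set {set U}}) :
    {set {set U}} :=
  match o with
  | MinimalHittingSet => minimal_hitting_sets F
  | Closure => intersection_closure F
  end.

Section ZDD.
Context {d : Order.disp_t} {U : finOrderType d}.
Implicit Types (F G A B : {set {set U}}) (S T : {set U}).

(* A node is [inl n] for an internal node [n], [inr true] for the terminal top
   and [inr false] for the terminal bottom. Acyclicity follows from the labels
   increasing along the arcs between internal nodes. *)
Record zdd := Zdd {
  inner : finType;
  label : inner -> U;
  lo : inner -> inner + bool;
  hi : inner -> inner + bool;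
  root : inner + bool;
  lo_lt : forall n n' : inner, lo n = inl n' -> (label n < label n')%O;
  hi_lt : forall n n' : inner, hi n = inl n' -> (label n < label n')%O
}.

Definition node (D : zdd) : finType := (inner D + bool)%type.

Definition num_nodes (D : zdd) : nat := #|node D|.

Inductive node_family (D : zdd) : node D -> {set {set U}} -> Prop :=
| family_top : node_family (inr true) [set set0]
| family_bot : node_family (inr false) set0
| family_inner (n : inner D) A B :
    node_family (lo n) A -> node_family (hi n) B ->
    node_family (inl n) (A :|: [set label n |: S | S in B]).

Definition represents (D : zdd) F := node_family (root D) F.

Definition arc (D : zdd) : rel (node D) :=
  fun x y => if x is inl n then (y == lo n) || (y == hi n) else false.

(* No two nodes can be merged, no node can be deleted, and every internal node
   is reachable from the root. Both terminals always belong to the diagram. *)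
Definition reduced (D : zdd) : Prop :=
  [/\ forall n n' : inner D,
        label n = label n' -> lo n = lo n' -> hi n = hi n' -> n = n',
      forall n : inner D, hi n <> inr false
    & forall n : inner D, connect (@arc D) (root D) (inl n)].

Definition lo_part (v : U) G := [set S in G | v \notin S].
Definition hi_part (v : U) G := [set S :\ v | S in [set S in G | v \in S]].

Lemma family_ge (D : zdd) (x : node D) A : node_family x A ->
  forall S u, S \in A -> u \in S -> exists2 n, x = inl n & (label n <= u)%O.
Proof.
elim=> [S u|S u|n A' B' _ IHlo _ IHhi S u].
- by rewrite inE => /eqP->; rewrite inE.
- by rewrite inE.
- rewrite inE => /orP[SA uS|/imsetP[T TB ->]].
    have [n' e h] := IHlo _ _ SA uS; exists n => //.
    exact: (Order.POrderTheory.le_trans (Order.POrderTheory.ltW (lo_lt e))).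
  rewrite !inE => /orP[/eqP->|uT]; first by exists n.
  have [n' e h] := IHhi _ _ TB uT; exists n => //.
  exact: (Order.POrderTheory.le_trans (Order.POrderTheory.ltW (hi_lt e))).
Qed.

Lemma family_cofactors (D : zdd) (n : inner D) A B :
  node_family (lo n) A -> node_family (hi n) B ->
  let G := A :|: [set label n |: S | S in B] in
  lo_part (label n) G = A /\ hi_part (label n) G = B.
Proof.
move=> hA hB G.
have nA S : S \in A -> label n \notin S.
  move=> SA; apply/negP => nS; have [n' e h] := family_ge hA SA nS.
  by have := Order.POrderTheory.lt_le_trans (lo_lt e) h;
     rewrite Order.POrderTheory.ltxx.
have nB S : S \in B -> label n \notin S.
  move=> SA; apply/negP => nS; have [n' e h] := family_ge hB SA nS.
  by have := Order.POrderTheory.lt_le_trans (hi_lt e) h;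
     rewrite Order.POrderTheory.ltxx.
split; apply/setP => S.
  rewrite !inE; apply/andP/idP => [[/orP[//|/imsetP[T _ ->]]]|SA].
    by rewrite !inE eqxx.
  by rewrite SA nA.
apply/imsetP/idP => [[T]|SB].
  rewrite !inE => /andP[/orP[/nA/negbTE->//|/imsetP[T' T'B ->]] _ ->].
  by rewrite setU1K ?nB.
exists (label n |: S); last by rewrite setU1K ?nB.
by rewrite !inE eqxx /= imset_f ?orbT.
Qed.

Lemma family_innerE (D : zdd) (n : inner D) G : node_family (inl n) G ->
  node_family (lo n) (lo_part (label n) G) /\ node_family (hi n) (hi_part (label n) G).
Proof.
move E: (inl n) => x h; case: h E => // n' A B hA hB [->].
by have [-> ->] := family_cofactors hA hB.
Qed.

Lemma family_recompose (v : U) G :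
  G = lo_part v G :|: [set v |: S | S in hi_part v G].
Proof.
apply/setP => S; rewrite !inE; apply/idP/orP => [SG|[/andP[]//|/imsetP[T]]].
  case: (boolP (v \in S)) => vS; [right|by left; rewrite SG].
  apply/imsetP; exists (S :\ v); last by rewrite setD1K.
  by apply: imset_f; rewrite inE SG.
by case/imsetP => T'; rewrite inE => /andP[T'G vT'] -> ->; rewrite setD1K.
Qed.

Lemma family_top_inv (D : zdd) G : node_family (D := D) (inr true) G -> G = [set set0].
Proof. by move E: (inr true) => x h; case: h E. Qed.

Lemma family_bot_inv (D : zdd) G : node_family (D := D) (inr false) G -> G = set0.
Proof. by move E: (inr false) => x h; case: h E. Qed.

Lemma family_fun (D : zdd) (x : node D) A B :
  node_family x A -> node_family x B -> A = B.
Proof.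
move=> h; elim: h B => [B /family_top_inv|B /family_bot_inv|] //.
move=> n A1 B1 _ IHlo _ IHhi B /family_innerE[/IHlo-> /IHhi->].
by rewrite -family_recompose.
Qed.

Lemma family_total (D : zdd) (x : node D) : exists A, node_family x A.
Proof.
case: x => [n|[]]; last by exists set0; constructor.
- have [k] := ubnP #|[set u | (label n <= u)%O]|; elim: k n => // k IH n.
  rewrite ltnS => le_k.
  have child (x : node D) : (forall n', x = inl n' -> (label n < label n')%O) ->
      exists A, node_family x A.
    case: x => [n'|[] _]; last by exists set0; constructor.
      move=> /(_ _ erefl) lt; apply: IH; apply: leq_trans le_k.
      apply: proper_card; apply/properP; split.
        apply/subsetP => u; rewrite !inE.
        exact: (Order.POrderTheory.le_trans (Order.POrderTheory.ltW lt)).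
      exists (label n); rewrite inE ?Order.POrderTheory.lexx //.
      by rewrite Order.POrderTheory.lt_geF.
    by exists [set set0]; constructor.
  have [A hA] := child _ (@lo_lt D n).
  have [B hB] := child _ (@hi_lt D n).
  by eexists; constructor; eassumption.
- by exists [set set0]; constructor.
Qed.

Lemma reduced_family_neq0 (D : zdd) (x : node D) A :
  reduced D -> node_family x A -> x <> inr false -> A != set0.
Proof.
case=> _ hibot _; elim=> // [_|n A' B' _ _ _ IHhi _].
  by apply/set0Pn; exists set0; rewrite inE.
have /set0Pn[S SB] := IHhi (hibot n).
by apply/set0Pn; exists (label n |: S); rewrite inE imset_f ?orbT.
Qed.

Lemma reduced_label_mem (D : zdd) (n : inner D) A :
  reduced D -> node_family (inl n) A -> exists2 S, S \in A & label n \in S.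
Proof.
move=> rD /family_innerE[_ hB]; have [_ hibot _] := rD.
have /set0Pn[S /imsetP[T]] := reduced_family_neq0 rD hB (@hibot n).
by rewrite inE => /andP[TA nT] _; exists T.
Qed.

Lemma reduced_family_inj (D : zdd) (x y : node D) A :
  reduced D -> node_family x A -> node_family y A -> x = y.
Proof.
move=> rD h; have [nodup _ _] := rD.
have term b (n : inner D) B : node_family (D := D) (inr b) B ->
    node_family (inl n) B -> False.
  move=> hb /(reduced_label_mem rD)[S SB nS].
  by have [] := family_ge hb SB nS.
elim: h y => [y|y|n A1 B1 hA IHlo hB IHhi y hy].
- case: y => [n|[]] // hy; first by case: (term true n [set set0]) => //; constructor.
  by have /setP/(_ set0) := family_bot_inv hy; rewrite !inE eqxx.
- case: y => [n|[]] // hy; first by case: (term false n set0) => //; constructor.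
  by have /setP/(_ set0) := family_top_inv hy; rewrite !inE eqxx.
have hx := family_inner hA hB.
case: y hy => [n'|b] hy; last by case: (term _ _ _ hy hx).
have en : label n = label n'.
  have [S SA nS] := reduced_label_mem rD hx.
  have [S' SA' nS'] := reduced_label_mem rD hy.
  have [_ [<-] le1] := family_ge hx SA' nS'.
  have [_ [<-] le2] := family_ge hy SA nS.
  by apply/Order.POrderTheory.le_anti/andP.
have [eA eB] := family_cofactors hA hB.
have [] := family_innerE hy; rewrite -en eA eB => /IHlo elo /IHhi ehi.
by congr inl; apply: nodup.
Qed.

Lemma family_descend (D : zdd) (y : node D) A (v : U) S0 :
    node_family y A -> S0 \in A -> v \in S0 ->
    (forall S u, S \in A -> u \in S -> (v <= u)%O) ->
  exists2 n, label n = v & node_family (D := D) (inl n) A.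
Proof.
elim=> [||n A1 B1 hA IHlo hB _ S0G vS0 vmin].
- by rewrite inE => /eqP->; rewrite inE.
- by rewrite inE.
have hx := family_inner hA hB.
have [_ [<-]] := family_ge hx S0G vS0.
rewrite Order.POrderTheory.le_eqVlt => /orP[/eqP e|lt]; first by exists n.
have B0 : B1 = set0.
  apply/eqP/set0Pn => -[S SB].
  have := vmin (label n |: S) (label n).
  by rewrite !inE eqxx imset_f ?orbT // Order.POrderTheory.lt_geF // => /(_ isT isT).
by move: S0G vmin; rewrite B0 imset0 setU0 => ? ?; apply: IHlo.
Qed.

Lemma reduced_minimal (D D' : zdd) F :
  reduced D -> represents D F -> represents D' F -> num_nodes D <= num_nodes D'.
Proof.
move=> rD hD hD'.
have reach (x : node D) : connect (@arc D) (root D) x ->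
    exists y : node D', exists A, node_family x A /\ node_family y A.
  case/connectP => p; elim/last_ind: p x => [x _ ->|p z IH x].
    by exists (root D'), F.
  rewrite rcons_path last_rcons => /andP[hp ha] ->.
  have [y [A [hx hy]]] := IH _ hp erefl.
  case: (last (root D) p) ha hx => // n ha hx.
  have [S SA nS] := reduced_label_mem rD hx.
  have vmin T u : T \in A -> u \in T -> (label n <= u)%O.
    by move=> TA uT; have [_ [<-]] := family_ge hx TA uT.
  have [n' en' hn'] := family_descend hy SA nS vmin.
  have [l1 h1] := family_innerE hx.
  have [l2 h2] := family_innerE hn'.
  rewrite en' in l2 h2.
  by case/orP: ha => /eqP->; [exists (lo n'), (lo_part (label n) A)
                             |exists (hi n'), (hi_part (label n) A)].
have corr (x : node D) :
    exists y : node D', exists A, node_family x A /\ node_family y A.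
  case: x => [n|[]]; first by apply: reach; case: rD.
    by exists (inr true), [set set0]; split; constructor.
  by exists (inr false), set0; split; constructor.
have [f hf] := fin_all_exists corr.
apply: (@leq_card _ _ f) => x1 x2 e.
have [A1 [hx1 hy1]] := hf x1; have [A2 [hx2 hy2]] := hf x2.
rewrite -e in hy2; rewrite -(family_fun hy1 hy2) in hx2.
exact: reduced_family_inj rD hx1 hx2.
Qed.

Section Canonical.
Variable F : {set {set U}}.

Let lab G : option U :=
  [pick u in cover G | [forall w in cover G, (u <= w)%O]].

Let lab_some G u : lab G = Some u ->
  u \in cover G /\ (forall w, w \in cover G -> (u <= w)%O).
Proof.
rewrite /lab; case: pickP => // v /andP[vG /forall_inP h] [<-].
by split.
Qed.

Let lab_none G : lab G = None -> cover G = set0.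
Proof.
rewrite /lab; case: pickP => // h _; apply/eqP/set0Pn => -[u0 u0G].
have [u uG umin] := Order.TotalTheory.arg_minP id u0G.
have /negP[] := negbT (h u); apply/andP; split=> //; exact/forall_inP.
Qed.

Let stp : rel {set {set U}} := fun G G' =>
  if lab G is Some v then (G' == lo_part v G) || (G' == hi_part v G) else false.

Let cinner := {G : {set {set U}} | isSome (lab G) && connect stp F G}.

Let clabel (n : cinner) : U :=
  match lab (val n) as o return isSome o -> U with
  | Some u => fun=> u
  | None => fun h => False_rect U (notF h)
  end (proj1 (andP (valP n))).

Let clabelE (n : cinner) : lab (val n) = Some (clabel n).
Proof. by rewrite /clabel; case: (lab _) (proj1 _). Qed.

Let tov G : cinner + bool :=
  if insub G is Some n then inl n else inr (set0 \in G).

Let clo (n : cinner) := tov (lo_part (clabel n) (val n)).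
Let chi (n : cinner) := tov (hi_part (clabel n) (val n)).

Let tov_inl G n : tov G = inl n -> val n = G.
Proof. by rewrite /tov; case: insubP => // m _ <- [->]. Qed.

Let mem_coverP G u : reflect (exists2 S, S \in G & u \in S) (u \in cover G).
Proof. by apply: (iffP bigcupP) => -[S]; exists S. Qed.

Let lo_part_cover v G u : (forall w, w \in cover G -> (v <= w)%O) ->
  u \in cover (lo_part v G) -> (v < u)%O.
Proof.
move=> vmin /mem_coverP[S]; rewrite inE => /andP[SG vS] uS.
rewrite Order.POrderTheory.lt_neqAle vmin ?andbT; last by apply/mem_coverP; exists S.
by apply: contraNneq vS => ->.
Qed.

Let hi_part_cover v G u : (forall w, w \in cover G -> (v <= w)%O) ->
  u \in cover (hi_part v G) -> (v < u)%O.
Proof.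
move=> vmin /mem_coverP[S /imsetP[T]]; rewrite inE => /andP[TG vT] ->.
rewrite !inE => /andP[nuv uT].
rewrite Order.POrderTheory.lt_neqAle eq_sym nuv vmin //.
by apply/mem_coverP; exists T.
Qed.

Let clo_lt (n n' : cinner) : clo n = inl n' -> (clabel n < clabel n')%O.
Proof.
move/tov_inl => e; have [_ vmin] := lab_some (clabelE n).
by apply: (lo_part_cover vmin); rewrite -e; have [] := lab_some (clabelE n').
Qed.

Let chi_lt (n n' : cinner) : chi n = inl n' -> (clabel n < clabel n')%O.
Proof.
move/tov_inl => e; have [_ vmin] := lab_some (clabelE n).
by apply: (hi_part_cover vmin); rewrite -e; have [] := lab_some (clabelE n').
Qed.

Let cD : zdd := @Zdd cinner clabel clo chi (tov F) clo_lt chi_lt.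

Let stp_lo (n : cinner) : connect stp F (lo_part (clabel n) (val n)).
Proof.
have /andP[_ h] := valP n; apply: connect_trans h (connect1 _).
by rewrite /stp clabelE eqxx.
Qed.

Let stp_hi (n : cinner) : connect stp F (hi_part (clabel n) (val n)).
Proof.
have /andP[_ h] := valP n; apply: connect_trans h (connect1 _).
by rewrite /stp clabelE eqxx orbT.
Qed.

Let tov_family_step (x : node cD) :
  (forall n, x = inl n -> node_family (D := cD) (inl n) (val n)) ->
  forall G, connect stp F G -> tov G = x -> node_family (D := cD) x G.
Proof.
move=> hx G FG e; case: x hx e => [n hx /tov_inl<-|b _]; first exact: hx.
rewrite /tov; case: insubP => //; rewrite FG andbT => hl [<-].
have /lab_none c0 : lab G = None by case: (lab G) hl.
have G0 S : S \in G -> S = set0.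
  by move=> SG; apply/eqP; rewrite -subset0 -c0; apply: bigcup_sup.
case: (boolP (set0 \in G)) => h.
  rewrite (_ : G = [set set0]); first by constructor.
  by apply/setP => S; rewrite inE; apply/idP/eqP => [/G0|->].
rewrite (_ : G = set0); first by constructor.
by apply/setP => S; rewrite inE; apply/negP => SG; rewrite -(G0 _ SG) SG in h.
Qed.

Let val_family (n : inner cD) : node_family (inl n) (val n).
Proof.
have [A hA] := family_total (inl n : node cD).
suff aux x B : node_family (D := cD) x B ->
    forall m, x = inl m -> node_family (D := cD) (inl m) (val m).
  exact: aux hA _ erefl.
elim=> // m A1 B1 _ IHlo _ IHhi _ [<-].
rewrite (family_recompose (clabel m) (val m)).
by apply: (family_inner (D := cD)); apply: tov_family_step => //.
Qed.

Let tov_family G : connect stp F G -> node_family (D := cD) (tov G) G.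
Proof. by move=> FG; apply: tov_family_step => // n _; apply: val_family. Qed.

Lemma exists_reduced : {D : zdd | reduced D /\ represents D F}.
Proof.
exists cD; split; last exact/tov_family/connect0.
split=> [n n' el elo ehi|n ehi|n].
- have [h1 h2] := family_innerE (val_family n).
  have [h1' h2'] := family_innerE (val_family n').
  rewrite elo ehi in h1 h2; apply: val_inj.
  rewrite (family_recompose (label n) (val n)).
  by rewrite (family_fun h1 h1') (family_fun h2 h2') el -family_recompose.
- have [_] := family_innerE (val_family n); rewrite ehi => /family_bot_inv h0.
  have [/mem_coverP[S Sn nS] _] := lab_some (clabelE n).
  have : S :\ clabel n \in hi_part (label n) (val n).
    by apply: imset_f; rewrite inE Sn.
  by rewrite h0 inE.
- have /andP[ln FG] := valP n.
  have <- : tov (val n) = inl n.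
    by rewrite /tov valK.
  change (connect (@arc cD) (tov F) (tov (val n))).
  case/connectP: FG => p; elim/last_ind: p (val n) => [G _ ->|p G IH G'].
    exact: connect0.
  rewrite rcons_path last_rcons => /andP[hp ha] ->.
  apply: connect_trans (IH _ hp erefl) (connect1 _).
  move: (ha); rewrite /stp; case E: (lab _) => [v|//] hv.
  have FL : connect stp F (last F p) by apply/connectP; exists p.
  rewrite /tov; case: insubP => [m _ em|]; last by rewrite E FL.
  have := clabelE m; rewrite em E => -[ev]; rewrite ev -em in hv.
  by case/orP: hv => /eqP->; rewrite /arc eqxx ?orbT.
Qed.

End Canonical.

Definition reduced_zdd F : zdd := sval (exists_reduced F).

(* $Z_<(F)$, where $<$ is the order of [U]; both terminals are counted. *)
Definition zdd_size F : nat := num_nodes (reduced_zdd F).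

Lemma reduced_zddP F : reduced (reduced_zdd F) /\ represents (reduced_zdd F) F.
Proof. exact: svalP (exists_reduced F). Qed.

Lemma zdd_size_min F (D : zdd) : represents D F -> zdd_size F <= num_nodes D.
Proof. by have [rD hD] := reduced_zddP F; apply: reduced_minimal. Qed.

Lemma zdd_size_reduced F (D : zdd) :
  reduced D -> represents D F -> num_nodes D = zdd_size F.
Proof.
move=> rD hD; apply/eqP; rewrite eqn_leq (zdd_size_min hD) andbT.
by have [_ hD'] := reduced_zddP F; apply: reduced_minimal hD'.
Qed.

End ZDD.

Arguments zdd {d} U.

(* f(m) = O(g(m)) as m tends to infinity. *)
Definition bigO (f g : nat -> nat) : Prop :=
  exists c N : nat, forall m, N <= m -> f m <= c * g m.

(* f(m) >= 2^m / p(m) for some polynomial p and all sufficiently large m; the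
   positivity of p(m) excludes the degenerate bounds given by p(m) <= 0. *)
Definition Omega_exp_over_poly (f : nat -> nat) : Prop :=
  exists (p : {poly rat}) (N : nat), forall m, N <= m ->
    (0 < p.[m%:R] /\ 2%:R ^+ m / p.[m%:R] <= (f m)%:R)%R.

(* Main.v *)
(** Take [U_m] to consist of m pairs [{x_i, y_i}], ordered with all the [x]
    before all the [y]. For minimal hitting sets let [F_m] be the set of these
    pairs, for closure the set of their complements. A family of m sets over 2m
    elements has a ZDD with at most [2 m^2 + 2] nodes, since a node is
    determined by its label and any member of the family whose path meets it.
    In [F_m^diamond] each of the [2^m] subsets [P] of the [x] can be completed
    by [y]-elements: by those [y_i] with [x_i] outside (respectively inside)
    [P]. These completions tell the subsets [P] apart, so the paths of the
    [2^m] prefixes [P] end in pairwise different nodes. *)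
Require Import Defs.
From mathcomp Require Import all_boot all_order all_algebra.

Set Implicit Arguments.
Unset Strict Implicit.
Unset Printing Implicit Defensive.

Import Order.TTheory GRing.Theory Num.Theory.

(** * Upper and lower bounds on the size of a reduced ZDD *)

Section ZDDBounds.
Context {d : Order.disp_t} {U : finOrderType d}.
Implicit Types (F A B : {set {set U}}) (S T P Q L : {set U}) (D : @zdd d U).

Lemma mem_hi_part v A S : (S \in hi_part v A) = (v |: S \in A) && (v \notin S).
Proof.
apply/imsetP/andP => [[T]|[vSA vS]].
  by rewrite inE => /andP[TA vT] ->; rewrite setD1K // !inE eqxx.
by exists (v |: S); rewrite ?setU1K // inE vSA !inE eqxx.
Qed.

(** [P] collects the labels of the nodes that a path from the root to [n] leaves through its
    hi-arcs. Each arc replaces the current family by a cofactor, so [A] depends on [F], [P] and the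
    label of [n] only. The lower bound on the elements of [T] accounts for the labels passed by
    lo-arcs or skipped. *)
Lemma reachable_family D F (n : inner D) A :
  represents D F -> connect (@Defs.arc _ _ D) (Defs.root D) (inl n) ->
  node_family (inl n) A ->
  exists2 P : {set U}, forall u, u \in P -> (u < label n)%O &
    forall T, (T \in A) = [forall u in T, label n <= u]%O && (P :|: T \in F).
Proof.
move=> hD /connectP[p]; elim/last_ind: p n A => [n A /= _ en hA|p z IH n A].
  exists set0 => [u|T]; first by rewrite inE.
  rewrite en in hA; rewrite (family_fun hA hD) set0U.
  apply/idP/andP => [TF|[]//]; split=> //; apply/forall_inP => u uT.
  by have [j] := family_ge hD TF uT; rewrite -en => -[<-].
rewrite rcons_path last_rcons => /andP[hp ha] ez hn.
rewrite -{}ez in ha.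
have {hp}IH k B e := IH k B hp (esym e).
case: (last (Defs.root D) p) ha IH => // k ha IH.
have [B hB] := family_total (inl k : node D).
have [P ltP memB] := IH _ _ erefl hB.
have [hlo hhi] := family_innerE hB.
case/orP: ha => /eqP en; rewrite en in hn.
  have lt_kn := lo_lt (esym en).
  exists P => [u /ltP uk|T]; first exact: lt_trans uk lt_kn.
  rewrite (family_fun hn hlo); apply/idP/andP => [TA|[/forall_inP leT PTF]].
    split; last by move: TA; rewrite inE memB => /andP[/andP[]].
    apply/forall_inP => u uT.
    by have [j] := family_ge hlo TA uT; rewrite -en => -[<-].
  rewrite inE memB PTF andbT; apply/andP; split.
    by apply/forall_inP => u /leT; apply: le_trans (ltW lt_kn).
  by apply/negP => /leT; rewrite leNgt lt_kn.
have lt_kn := hi_lt (esym en).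
exists (label k |: P) => [u|T].
  by case/setU1P => [->//|/ltP uk]; apply: lt_trans uk lt_kn.
rewrite (family_fun hn hhi) (setUC [set label k]) -setUA.
apply/idP/andP => [TA|[/forall_inP leT PTF]].
  split; last by move: TA; rewrite mem_hi_part memB => /andP[/andP[]].
  apply/forall_inP => u uT.
  by have [j] := family_ge hhi TA uT; rewrite -en => -[<-].
rewrite mem_hi_part memB PTF andbT; apply/andP; split.
  apply/forall_inP => u /setU1P[->//|/leT].
  exact: le_trans (ltW lt_kn).
by apply/negP => /leT; rewrite leNgt lt_kn.
Qed.

Lemma zdd_size_le F : zdd_size F <= #|F| * #|U| + 2.
Proof.
have [rD hD] := reduced_zddP F.
rewrite /zdd_size /num_nodes /node; move: (reduced_zdd F) rD hD => D rD hD.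
rewrite card_sum card_bool leq_add2r.
have [_ _ reach] := rD.
have on_path (n : inner D) : exists Sv : {set U} * U, [/\ Sv.1 \in F, Sv.2 = label n &
    exists2 A, node_family (inl n) A & forall T, (T \in A) =
      [forall u in T, label n <= u]%O &&
      ([set u in Sv.1 | (u < label n)%O] :|: T \in F)].
  have [A hA] := family_total (inl n : node D).
  have [P ltP memA] := reachable_family hD (reach n) hA.
  have [S SA _] := reduced_label_mem rD hA.
  move: (SA); rewrite memA => /andP[/forall_inP leS PSF].
  (* [A] is nonempty because the diagram is reduced. All of [S] lies at or above the label of [n]
     and all of [P] below, so cutting [P :|: S] at the label recovers [P]. *)
  exists (P :|: S, label n); split=> //=; exists A => // T.
  rewrite memA; congr (_ && (_ :|: _ \in F)); apply/setP => u; rewrite !inE.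
  apply/idP/andP => [uP|[/orP[//|/leS]]]; first by rewrite uP ltP.
  by rewrite leNgt => /negbTE->.
have [f hf] := fin_all_exists on_path.
have f_inj : injective f.
  move=> n k e; have [_ ln [A hA memA]] := hf n; have [_ lk [B hB memB]] := hf k.
  (* In a reduced diagram distinct nodes represent distinct families. *)
  suff eAB : A = B.
    by rewrite -eAB in hB; have [] := reduced_family_inj rD hA hB.
  by apply/setP => T; rewrite memA memB -ln -lk e.
rewrite -cardsT -(card_imset _ f_inj) -cardsT -cardsX.
apply/subset_leq_card/subsetP => _ /imsetP[n _ ->].
by rewrite !inE andbT; have [] := hf n.
Qed.

(** Since [L] is an initial segment, one can descend from [x] while labels stay in [L], taking the
    hi-arc exactly at labels in [P]. The node where this stops is [y], unless some element of [P]
    was skipped: then no member of [A] extends [P] in this way and the bottom terminal serves. *)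
Lemma exists_cofactor L D (x : node D) A P :
  (forall u v, u \in L -> v \notin L -> (u < v)%O) ->
  node_family x A -> P \subset L ->
  exists y : node D, exists2 B, node_family y B &
    forall T, [disjoint T & L] -> (T \in B) = (P :|: T \in A).
Proof.
move=> ltL hA; elim: hA P => {x A} [P|P|n A B hA IHlo hB IHhi P] PL.
- have [->|P0] := eqVneq P set0.
    exists (inr true), [set set0]; first by constructor.
    by move=> T _; rewrite set0U.
  exists (inr false), set0; first by constructor.
  by move=> T _; rewrite !inE setU_eq0 (negbTE P0).
- exists (inr false), set0; first by constructor.
  by move=> T _; rewrite !inE.
have hG := family_inner hA hB; set G := (X in node_family _ X) in hG; rewrite -/G.
have [eA eB] := family_cofactors hA hB; rewrite -/G in eA eB.
clearbody G.
have [nL|nL] := boolP (label n \in L).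
  have nT T : [disjoint T & L] -> label n \notin T.
    by move=> TL; apply/negP => /(disjointFr TL); rewrite nL.
  have [nP|nP] := boolP (label n \in P).
    have [|y [C hC memC]] := IHhi (P :\ label n).
      by apply: subset_trans PL; apply: subsetDl.
    exists y, C => // T TL; rewrite memC // -eB mem_hi_part setUA setD1K //.
    by rewrite !inE eqxx /= nT // andbT.
  have [y [C hC memC]] := IHlo _ PL.
  by exists y, C => // T TL; rewrite memC // -eA !inE negb_or nP nT // !andbT.
(* The label is now beyond [L], hence so are all elements of members of [G]; what is left of [P]
   must be empty for any member to contain it. *)
have [->|/set0Pn[u uP]] := eqVneq P set0.
  by exists (inl n), G => // T _; rewrite set0U.
exists (inr false), set0; first by constructor.
move=> T _; rewrite inE; apply/esym/negP => PTG.
have uPT : u \in P :|: T by rewrite inE uP.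
have [_ [<-]] := family_ge hG PTG uPT.
by rewrite leNgt ltL // (subsetP PL).
Qed.

(** If the prefixes [P] and [Q] lead to the same node, then [g P] completes [Q] as well, so
    [P \subset Q]; exchanging the roles gives equality. Thus the subsets of [L] inject into the
    nodes. *)
Lemma zdd_size_ge L F (g : {set U} -> {set U}) :
  (forall u v, u \in L -> v \notin L -> (u < v)%O) ->
  (forall P, P \subset L -> [disjoint g P & L] /\ P :|: g P \in F) ->
  (forall P Q, P \subset L -> Q \subset L -> Q :|: g P \in F -> P \subset Q) ->
  2 ^ #|L| <= zdd_size F.
Proof.
move=> ltL gF gsub; rewrite /zdd_size /num_nodes.
have [_] := reduced_zddP F; move: (reduced_zdd F) => D hD.
have cof (P : {set U}) : exists y : node D, P \subset L ->
    exists2 B, node_family y B &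
      forall T, [disjoint T & L] -> (T \in B) = (P :|: T \in F).
  (* The root is a dummy value that makes [f] total. *)
  have [PL|_] := boolP (P \subset L); last by exists (Defs.root D).
  by have [y hy] := exists_cofactor ltL hD PL; exists y.
have [f hf] := fin_all_exists cof.
have f_sub P Q : P \subset L -> Q \subset L -> f P = f Q -> P \subset Q.
  move=> PL QL e; have [B hB memB] := hf P PL; have [C hC memC] := hf Q QL.
  rewrite -e in hC; have eBC := family_fun hB hC; have [gL gPF] := gF P PL.
  by apply: gsub => //; rewrite -memC // -eBC memB.
rewrite -card_powerset -(@card_in_imset _ _ f) ?max_card // => P Q.
rewrite !powersetE => PL QL e.
by apply/eqP; rewrite eqEsubset; apply/andP; split; apply: f_sub.
Qed.

End ZDDBounds.

(** * The families of pairs and of their complements *)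

Section Pairs.
Variable m : nat.
Implicit Types (i j : 'I_m) (P Q S T : {set 'I_(m + m)}).

(** The elements [lshift m i] are the $x_i$ and the [rshift m i] the $y_i$; the order of the
    ordinals puts the former first. *)
Definition left_half : {set 'I_(m + m)} := [set lshift m i | i : 'I_m].

Definition pair_of i : {set 'I_(m + m)} := [set lshift m i; rshift m i].

Lemma card_left_half : #|left_half| = m.
Proof. by rewrite card_imset ?card_ord //; apply: lshift_inj. Qed.

Lemma lshift_left_half i : lshift m i \in left_half.
Proof. exact: imset_f. Qed.

Lemma rshift_left_half i : (rshift m i \in left_half) = false.
Proof.
by apply/negP => /imsetP[j _ /eqP]; rewrite eq_sym eq_lrshift.
Qed.

Lemma left_half_lt (u v : 'I_(m + m)) :
  u \in left_half -> v \notin left_half -> (u < v)%O.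
Proof.
case/imsetP => i _ ->; case: (split_ordP v) => j ->.
  by rewrite lshift_left_half.
by rewrite ltEord /= ltn_addr.
Qed.

Lemma disjoint_rshift (p : pred 'I_m) :
  [disjoint [set rshift m i | i : 'I_m & p i] & left_half].
Proof.
rewrite disjoint_subset; apply/subsetP => _ /imsetP[i _ ->].
by rewrite inE rshift_left_half.
Qed.

Lemma mem_rshift (p : pred 'I_m) P i : P \subset left_half ->
  (rshift m i \in P :|: [set rshift m j | j : 'I_m & p j]) = p i.
Proof.
move=> /subsetP PL; rewrite inE.
have /negbTE-> /= : rshift m i \notin P.
  by apply/negP => /PL; rewrite rshift_left_half.
by rewrite mem_imset ?inE //; apply: rshift_inj.
Qed.

Lemma mem_lshift (p : pred 'I_m) P i :
  (lshift m i \in P :|: [set rshift m j | j : 'I_m & p j]) = (lshift m i \in P).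
Proof.
rewrite inE orbC; case: imsetP => //= -[j _ /eqP].
by rewrite eq_lrshift.
Qed.

Definition pairs : {set {set 'I_(m + m)}} := [set pair_of i | i : 'I_m].

Definition copairs : {set {set 'I_(m + m)}} := [set ~: pair_of i | i : 'I_m].

Lemma hitting_pairsP S :
  reflect (forall i, (lshift m i \in S) || (rshift m i \in S))
          (S \in hitting_sets pairs).
Proof.
rewrite inE; apply: (iffP forall_inP) => [h i|h _ /imsetP[i _ ->]].
  have /set0Pn[u] := h _ (imset_f pair_of (isT : i \in 'I_m)).
  by rewrite inE => /andP[uS /set2P[]<-]; rewrite uS ?orbT.
by apply/set0Pn; case/orP: (h i) => iS; [exists (lshift m i)|exists (rshift m i)];
  rewrite inE iS !inE eqxx ?orbT.
Qed.

(** [S] has exactly one element in each pair, and a hitting subset of [S] has to keep it. *)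
Lemma minimal_hitting_pairs S :
  (forall i, (rshift m i \in S) = (lshift m i \notin S)) ->
  S \in minimal_hitting_sets pairs.
Proof.
move=> hS; rewrite inE; apply/andP; split.
  by apply/hitting_pairsP => i; rewrite hS orbN.
apply/forall_inP => T /hitting_pairsP hT; apply/implyP => /subsetP TS.
rewrite eqEsubset andbC; apply/andP; split; first exact/subsetP.
apply/subsetP => u; case: (split_ordP u) => i -> uS; have := hT i.
  case/orP => [//|/TS]; by rewrite hS uS.
by case/orP => [/TS iS|//]; move: uS; rewrite hS iS.
Qed.

(** A complement of a pair contains both or neither of $x_i, y_i$, and intersections preserve this.
    Conversely, a union of pairs is the intersection of the complements of the pairs it misses; if
    it misses none, this is the empty intersection. *)
Lemma closure_copairsP S :
  reflect (forall i, (lshift m i \in S) = (rshift m i \in S))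
          (S \in intersection_closure copairs).
Proof.
apply: (iffP imsetP) => [[G]|hS].
  rewrite powersetE => /subsetP Gc -> i.
  suff sub (u v : 'I_(m + m)) : u \in pair_of i -> v \in pair_of i ->
      u \in \bigcap_(T in G) T -> v \in \bigcap_(T in G) T.
    by apply/idP/idP; apply: sub; rewrite !inE eqxx ?orbT.
  move=> ui vi /bigcapP uG; apply/bigcapP => T TG; move: (uG T TG).
  have /imsetP[j _ ->] := Gc T TG; rewrite !inE; apply: contra.
  case/set2P: ui => ->; case/set2P: vi => ->;
    by rewrite ?eq_lrshift ?eq_rlshift ?orbF ?eq_lshift ?eq_rshift.
exists [set ~: pair_of i | i : 'I_m & lshift m i \notin S].
  rewrite powersetE; apply/subsetP => _ /imsetP[i _ ->]; exact: imset_f.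
apply/setP => u; apply/idP/bigcapP => [uS T /imsetP[i]|h].
  rewrite inE => iS ->; rewrite !inE; apply: contra iS.
  by case/orP => /eqP e; move: uS; rewrite e ?hS.
apply/negPn/negP => uS.
have [i ui iS] : exists2 i, u \in pair_of i & lshift m i \notin S.
  by case: (split_ordP u) uS => i -> iS; exists i; rewrite ?inE ?eqxx ?orbT // hS.
suff /h : ~: pair_of i \in [set ~: pair_of j | j : 'I_m & lshift m j \notin S].
  by rewrite inE ui.
by apply: imset_f; rewrite inE.
Qed.

Lemma zdd_size_image_le (f : 'I_m -> {set 'I_(m + m)}) :
  zdd_size [set f i | i : 'I_m] <= 2 * m ^ 2 + 2.
Proof.
apply: leq_trans (zdd_size_le _) _; rewrite leq_add2r -mulnn mulnCA.
apply: leq_mul; last by rewrite card_ord addnn mul2n.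
by apply: leq_trans (leq_imset_card _ _) _; rewrite card_ord.
Qed.

Lemma zdd_size_hitting : 2 ^ m <= zdd_size (minimal_hitting_sets pairs).
Proof.
rewrite -[m in X in X <= _]card_left_half.
apply: (@zdd_size_ge _ _ _ _
  (fun P => [set rshift m i | i : 'I_m & lshift m i \notin P])).
- exact: left_half_lt.
- move=> P PL; split; first exact: disjoint_rshift.
  by apply: minimal_hitting_pairs => i; rewrite mem_rshift // mem_lshift.
move=> P Q PL QL; rewrite inE => /andP[/hitting_pairsP h _].
apply/subsetP => u uP; have /imsetP[i _ ui] := subsetP PL _ uP.
(* As $x_i$ is in [P], the completion omits $y_i$, so only $x_i$ in [Q] can hit the pair. *)
by have := h i; rewrite mem_rshift // mem_lshift -ui uP orbF.
Qed.

Lemma zdd_size_closure : 2 ^ m <= zdd_size (intersection_closure copairs).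
Proof.
rewrite -[m in X in X <= _]card_left_half.
apply: (@zdd_size_ge _ _ _ _
  (fun P => [set rshift m i | i : 'I_m & lshift m i \in P])).
- exact: left_half_lt.
- move=> P PL; split; first exact: disjoint_rshift.
  by apply/closure_copairsP => i; rewrite mem_rshift // mem_lshift.
move=> P Q PL QL /closure_copairsP h.
apply/subsetP => u uP; have /imsetP[i _ ui] := subsetP PL _ uP.
(* As $x_i$ is in [P], the completion contains $y_i$, which forces $x_i$ into [Q]. *)
by have := h i; rewrite mem_rshift // mem_lshift -ui uP.
Qed.

End Pairs.

Theorem theorem12 (o : unary_op) :
  exists (d : Order.disp_t) (U : nat -> finOrderType d)
         (F : forall m : nat, {set {set U m}}),
    [/\ bigO (fun m => #|U m|) (fun m => m ^ 2),
        bigO (fun m => zdd_size (F m)) (fun m => m ^ 4)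
      & Omega_exp_over_poly (fun m => zdd_size (apply_op o (F m)))].
Proof.
exists _, (fun m => 'I_(m + m) : finOrderType _),
  (fun m => if o is MinimalHittingSet then pairs m else copairs m).
split.
- exists 2, 1 => m m_gt0.
  by rewrite card_ord addnn -mul2n leq_mul2l -mulnn leq_pmulr.
- exists 4, 1 => m m_gt0; apply: (@leq_trans (2 * m ^ 2 + 2)).
    by case: o; apply: zdd_size_image_le.
  (* For positive [m] both $2m^2$ and $2$ are at most $2m^4$, whence the constant 4. *)
  apply: (@leq_trans (2 * m ^ 4 + 2 * m ^ 4)); last by rewrite -mulnDl.
  apply: leq_add; first by rewrite leq_mul2l leq_pexp2l.
  by rewrite -[leqLHS]muln1 leq_mul2l expn_gt0 m_gt0.
exists 1%R, 0 => m _; rewrite hornerC; split; first exact: ltr01.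
rewrite divr1 -natrX ler_nat; case: o.
  exact: zdd_size_hitting.
exact: zdd_size_closure.
Qed.
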